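(* Consider a stream of triples $(q_i,k_i,v_i)\in(\mathbb{R}^d)^3$, $i\in[n]$, and a window size $W>0$. Assume that for all $(i,j)\in[n]\times[d]$ it holds that $|\operatorname{Attn}_W(q_i,K_i,V_i)_j|=\Omega(1)$. Then there exists an algorithm that uses $O(\|V\|_\infty\cdot\varepsilon^{-2}\cdot\log(nd/\delta))$ independent samples of the estimator given by the Sliding Window Attention algorithm (described in the context) to produce an estimator $\widehat{O}_i$ such that with probability at least $1-\delta$ it holds for all $i\in[n]$ and $j\in[d]$ that $$|\widehat{O}_{ij}-\operatorname{Attn}_W(q_i,K_i,V_i)_j|\le\varepsilon\cdot\operatorname{Attn}_W(q_i,K_i,V_i)_j .$$ Overall, this algorithm has space complexity $O(dW\cdot\|V\|_\infty\cdot\varepsilon^{-2}\cdot\log(nd/\delta))$.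
   Context: $K_i$ and $V_i$ are the $i\times d$ matrices whose rows are $k_1^T,\dots,k_i^T$ and $v_1^T,\dots,v_i^T$; $V=V_n$, and $\|V\|_\infty$ denotes the largest absolute value of an entry of $V$. Here $\varepsilon,\delta\in(0,1)$ are accuracy and failure-probability parameters. Sliding window attention with unmasked values: let $S_i:=K_iq_i\in\mathbb{R}^i$, let $M\in\mathbb{R}^i$ be the mask $M_\ell=\mathbb{1}\{\ell>i-W\}$, and $h(S_i):=S_i\circ M$ (element-wise product). Then $\operatorname{Attn}_W(q_i,K_i,V_i):=\sigma(h(S_i))^TV_i\in\mathbb{R}^d$, where $\sigma$ is the softmax on $\mathbb{R}^i$; i.e. for $i>W$ the softmax is taken of the scores $(0,\dots,0,q_i^Tk_{i-W+1},\dots,q_i^Tk_i)$, and positions outside the window still contribute their value vectors with unnormalized weight $1$. Sliding Window Attention algorithm (window size $W$). Maintain lists $K,V$ of stored keys and values, initially empty. (1) For $i=1,\dots,W$: receive $(q_i,k_i,v_i)$; append $k_i$ to $K$ and $v_i$ to $V$; output $\operatorname{Attn}_W(q_i,K,V)$ by direct calculation. (2) Initialize $v_s\leftarrow\emptyset$ (a stored value vector from outside the window). (3) For $i=W+1,\dots,n$: receive $(q_i,k_i,v_i)$; pop the first (oldest) element of $V$, calling it $v$, and remove the first element of $K$; append $k_i$ to $K$ and $v_i$ to $V$; with probability $(i-W)^{-1}$ replace $v_s\leftarrow v$ (reservoir sampling); let $S:=(i-W)+\sum_{k\in K}e^{q_i^Tk}$; with probability $(S-i+W)/S$ sample $\ell\in\{i-W+1,\dots,i\}$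 with probability proportional to $e^{q_i^Tk_\ell}$ and output $v_\ell$; otherwise output $v_s$. The estimator at step $i$ is the output $O_i\in\mathbb{R}^d$ of this algorithm; independent samples are obtained by running independent copies in parallel on the same stream. Space is counted as the number of stored scalars (real coordinates).
   Formalization: The error bound is ε·|Attn_W(q_i,K_i,V_i)_j| instead of ε·Attn_W(q_i,K_i,V_i)_j; the O-constants may also depend on any κ with Attn_W(q_i,K_i,|V_i|)_j ≤ κ·|Attn_W(q_i,K_i,V_i)_j| for all i,j; the quantity inside O(·) is rounded up to an integer. *)

(* Defs.v *)
From mathcomp Require Import all_boot all_order all_algebra.
From mathcomp Require Import all_classical all_reals all_analysis.

Set Implicit Arguments.
Unset Strict Implicit.
Unset Printing Implicit Defensive.

Import Order.TTheory GRing.Theory Num.Theory.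

Local Open Scope ring_scope.

(* Finitely supported distributions, as lists of (probability, outcome);      *)
(* an outcome may be listed several times, its probabilities then add up.     *)
Definition dist (R : realType) (T : Type) := seq (R * T).

Section Distributions.
Variable R : realType.

Definition dret (T : Type) (x : T) : dist R T := [:: (1, x)].

Definition dbind (T U : Type) (D : dist R T) (f : T -> dist R U) : dist R U :=
  flatten [seq [seq (px.1 * qy.1, qy.2) | qy <- f px.2] | px <- D].

Definition coin (p : R) : dist R bool := [:: (p, true); (1 - p, false)].

Definition categorical (T : Type) (ws : seq R) (xs : seq T) : dist R T :=
  zip [seq w / \sum_(z <- ws) z | w <- ws] xs.

Fixpoint iid (T : Type) (m : nat) (D : dist R T) : dist R (m.-tuple T) :=
  if m is m'.+1 then
    dbind D (fun x => dbind (iid m' D) (fun xs => dret [tuple of x :: xs]))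
  else dret [tuple].

Definition outcomes (T : Type) (D : dist R T) : seq T := [seq px.2 | px <- D].

Definition Pr (T : Type) (D : dist R T) (A : pred T) : R :=
  \sum_(px <- D | A px.2) px.1.

End Distributions.

Notation "'draw' x 'from' D ;; e" := (dbind D (fun x => e))
  (at level 200, x name, D at level 100, e at level 200, right associativity).

Section Attention.
Variables (R : realType) (d W : nat).

Definition softmax (i : nat) (S : 'cV[R]_i) : 'cV[R]_i :=
  \col_l (expR (S l 0) / \sum_(l' < i) expR (S l' 0)).

(* The position with 0-based index l has 1-based index l.+1; the truncation   *)
(* of i - W is harmless because l.+1 is positive.                             *)
Definition mask (i : nat) : 'cV[R]_i := \col_(l < i) (i - W < l.+1)%N%:R.

Definition masked (i : nat) (S : 'cV[R]_i) : 'cV[R]_i :=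
  \col_l (S l 0 * mask i l 0).

Definition attn (i : nat) (q : 'rV[R]_d) (K V : 'M[R]_(i, d)) : 'rV[R]_d :=
  (softmax (masked (K *m q^T)))^T *m V.

(* The first i.+1 rows: step number i.+1 of the stream has index i : 'I_n.    *)
Definition first_rows (n : nat) (i : 'I_n) (A : 'M[R]_(n, d)) : 'M[R]_(i.+1, d) :=
  rowsub (widen_ord (ltn_ord i)) A.

Definition rows_mx (i : nat) (s : seq 'rV[R]_d) : 'M[R]_(i, d) :=
  \matrix_(l < i) nth 0 s l.

(* Stored keys, stored values (oldest first), and v_s (None when empty).      *)
Definition state : Type := seq 'rV[R]_d * seq 'rV[R]_d * option 'rV[R]_d.

Definition empty_state : state := ([::], [::], None).

Definition scalars (st : state) : nat :=
  let: (K, V, vs) := st in d * (size K + size V + isSome vs).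

(* Step number i (from 1): new state and output. For W < i, v_s was set with  *)
(* probability 1 at step W.+1, so the default 0 of odflt has probability 0.   *)
Definition swa_step (i : nat) (st : state)
    (qkv : 'rV[R]_d * 'rV[R]_d * 'rV[R]_d) : dist R (state * 'rV[R]_d) :=
  let: (K, V, vs) := st in
  let: (q, k, v) := qkv in
  if (i <= W)%N then
    let K' := rcons K k in
    let V' := rcons V v in
    dret R ((K', V', vs), attn q (rows_mx i K') (rows_mx i V'))
  else
    let old := head 0 V in
    let K' := rcons (behead K) k in
    let V' := rcons (behead V) v in
    let ws := [seq expR ((q *m k'^T) 0 0) | k' <- K'] in
    let S := (i - W)%:R + \sum_(w <- ws) w in
    draw replace from coin (i - W)%:R^-1 ;;
    let vs' := if replace then Some old else vs in
    draw inside from coin ((S - i%:R + W%:R) / S) ;;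
    draw o from (if inside then categorical ws V' else dret R (odflt 0 vs')) ;;
    dret R ((K', V', vs'), o).

(* Traces: after each step, the state and the output of that step.            *)
Fixpoint swa_from (i : nat) (st : state)
    (s : seq ('rV[R]_d * 'rV[R]_d * 'rV[R]_d)) : dist R (seq (state * 'rV[R]_d)) :=
  if s is x :: s' then
    draw r from swa_step i st x ;;
    draw t from swa_from i.+1 r.1 s' ;;
    dret R (r :: t)
  else dret R [::].

Definition swa (n : nat) (Q K V : 'M[R]_(n, d)) :
    dist R (seq (state * 'rV[R]_d)) :=
  swa_from 1 empty_state [seq (row i Q, row i K, row i V) | i <- enum 'I_n].

Definition at_step (t : seq (state * 'rV[R]_d)) (i : nat) : state * 'rV[R]_d :=
  nth (empty_state, 0) t i.

Definition samples (m : nat) (ts : m.-tuple (seq (state * 'rV[R]_d))) (i : nat) :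
    m.-tuple 'rV[R]_d :=
  [tuple of [seq (at_step t i).2 | t <- ts]].

(* All m copies are charged for their state and for the sample they pass on   *)
(* to the aggregation, which keeps nothing else between steps.                *)
Definition total_scalars (m : nat) (ts : m.-tuple (seq (state * 'rV[R]_d))) (i : nat) :
    nat :=
  (\sum_(t <- ts) (scalars (at_step t i).1 + d))%N.

End Attention.

(* Main.v *)
Require Import Defs.
From mathcomp Require Import all_boot all_order all_algebra.
From mathcomp Require Import all_classical all_reals all_analysis.
From mathcomp Require Import ring lra zify.

(* The aggregated estimator is the sample mean. By the reservoir-sampling
   invariant (after k > W steps the stored value is uniform over the k - W values
   that left the window), the output at step i > W is a value v_l drawn with its
   softmax weight p_l. Its j-th coordinate therefore has mean
   mu = Attn_W(q_i, K_i, V_i)_j and variance at most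
   sum_l p_l v_lj^2 <= ||V|| sum_l p_l |v_lj| <= kappa ||V|| |mu|.
   With e^y <= 1 + y + 2 y^2 for y <= 1/2, the Chernoff bound with parameter
   t = eps / (4 (kappa + 1) ||V||) bounds each one-sided failure probability by
   exp(- m eps^2 |mu| / (8 (kappa + 1) ||V||)), and a union bound over (i, j)
   concludes. *)

Set Implicit Arguments.
Unset Strict Implicit.
Unset Printing Implicit Defensive.

Import Order.TTheory GRing.Theory Num.Theory.

Local Open Scope ring_scope.

(** * Expectations over finitely supported distributions *)

Section Expectation.
Context {R : realType}.

Definition expect {T : Type} (D : dist R T) (f : T -> R) : R :=
  \sum_(px <- D) px.1 * f px.2.

(** A [dist] is a bare list of weighted outcomes: neither nonnegativity nor total mass 1 is built
    in, so both are established separately for each sampler. *)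
Definition nonneg {T : Type} (D : dist R T) : bool := all (fun px => 0 <= px.1) D.

Lemma expect_dret (T : Type) (x : T) (f : T -> R) : expect (dret R x) f = f x.
Proof. by rewrite /expect /dret big_seq1 mul1r. Qed.

Lemma expect_dbind (T U : Type) (D : dist R T) (g : T -> dist R U) (f : U -> R) :
  expect (dbind D g) f = expect D (fun x => expect (g x) f).
Proof.
rewrite /expect /dbind big_flatten big_map; apply: eq_bigr => px _.
by rewrite big_map mulr_sumr; apply: eq_bigr => qy _; rewrite mulrA.
Qed.

Lemma expect_coin (p : R) (f : bool -> R) :
  expect (coin p) f = p * f true + (1 - p) * f false.
Proof. by rewrite /expect /coin big_cons big_seq1. Qed.

Lemma expect_categorical (T : Type) (ws : seq R) (xs : seq T) (f : T -> R) :
  expect (categorical ws xs) f =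
  (\sum_(w <- ws) w)^-1 * \sum_(wx <- zip ws xs) wx.1 * f wx.2.
Proof.
rewrite /expect /categorical; move: (\sum_(w <- ws) w) => z.
elim: ws xs => [|w ws IH] [|x xs] /=; rewrite ?big_nil ?mulr0 //.
by rewrite !big_cons IH /= mulrDr; congr (_ + _); rewrite mulrCA mulrA.
Qed.

(** Agreement on the support is enough, so invariants proved for outcomes can be used under an
    expectation. *)
Lemma eq_expect (T : eqType) (D : dist R T) (f g : T -> R) :
  {in outcomes D, f =1 g} -> expect D f = expect D g.
Proof.
move=> fg; apply: eq_big_seq => px pxD.
by rewrite fg //; apply: map_f.
Qed.

Lemma expectD (T : Type) (D : dist R T) (f g : T -> R) :
  expect D (fun x => f x + g x) = expect D f + expect D g.
Proof. by rewrite -big_split; apply: eq_bigr => px _; rewrite mulrDr. Qed.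

Lemma expectZ (T : Type) (D : dist R T) (a : R) (f : T -> R) :
  expect D (fun x => a * f x) = a * expect D f.
Proof. by rewrite mulr_sumr; apply: eq_bigr => px _; rewrite mulrCA. Qed.

Lemma expect_sum (T : Type) (I : finType) (D : dist R T) (f : I -> T -> R) :
  expect D (fun x => \sum_i f i x) = \sum_i expect D (f i).
Proof. by rewrite exchange_big; apply: eq_bigr => px _; rewrite mulr_sumr. Qed.

Lemma le_expect (T : Type) (D : dist R T) (f g : T -> R) :
  nonneg D -> (forall x, f x <= g x) -> expect D f <= expect D g.
Proof.
rewrite /expect; elim: D => [|px D IH] /=; first by rewrite !big_nil.
case/andP=> p0 D0 fg; rewrite !big_cons lerD ?IH //.
exact: ler_wpM2l.
Qed.

Lemma Pr_expect (T : Type) (D : dist R T) (A : pred T) :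
  Pr D A = expect D (fun x => (A x)%:R).
Proof.
by rewrite /Pr big_mkcond; apply: eq_bigr => px _; case: (A _); rewrite ?mulr1 ?mulr0.
Qed.

Lemma nonneg_dret (T : Type) (x : T) : nonneg (dret R x).
Proof. by rewrite /nonneg /= ler01. Qed.

Lemma nonneg_dbind (T U : Type) (D : dist R T) (g : T -> dist R U) :
  nonneg D -> (forall x, nonneg (g x)) -> nonneg (dbind D g).
Proof.
move=> D0 g0; elim: D D0 => [|px D IH] //= /andP [p0 D0].
rewrite /nonneg /dbind /= all_cat; apply/andP; split; last exact: IH.
by rewrite all_map; apply: sub_all (g0 px.2) => qy q0 /=; rewrite mulr_ge0.
Qed.

Lemma nonneg_coin (p : R) : 0 <= p <= 1 -> nonneg (coin p).
Proof. by case/andP=> p0 p1; rewrite /nonneg /= p0 subr_ge0 p1. Qed.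

Lemma nonneg_categorical (T : Type) (ws : seq R) (xs : seq T) :
  all (fun w => 0 <= w) ws -> nonneg (categorical ws xs).
Proof.
move=> ws0; have : 0 <= \sum_(w <- ws) w.
  by rewrite big_seq sumr_ge0 // => w /(allP ws0).
rewrite /nonneg /categorical; move: (\sum_(w <- ws) w) => z z0.
elim: ws ws0 xs => [|w ws IH] /=; first by move=> _ [].
by case/andP=> w0 ws0 [|x xs] //=; rewrite divr_ge0 // IH.
Qed.

Lemma outcomes_dbind (T U : eqType) (D : dist R T) (g : T -> dist R U) (y : U) :
  y \in outcomes (dbind D g) ->
  exists2 x, x \in outcomes D & y \in outcomes (g x).
Proof.
case/mapP=> [[r y']] /flattenP [s /mapP [px pxD ->]] /mapP [qy qyg [_ ->]] ->.
by exists px.2; apply/mapP; [exists px | exists qy].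
Qed.

Lemma nonneg_iid (T : Type) (m : nat) (D : dist R T) : nonneg D -> nonneg (iid m D).
Proof.
move=> D0; elim: m => [|m IH]; first exact: nonneg_dret.
apply: nonneg_dbind => // x; apply: nonneg_dbind => // xs; exact: nonneg_dret.
Qed.

(** Independence enters here: the moment generating function of a sum of [m] copies is an [m]-th
    power. *)
Lemma expect_iid_prod (T : Type) (m : nat) (D : dist R T) (f : T -> R) :
  expect (iid m D) (fun ts => \prod_(t <- ts) f t) = expect D f ^+ m.
Proof.
elim: m => [|m IH]; first by rewrite expect_dret big_nil expr0.
rewrite /= expect_dbind exprS -IH mulrC -expectZ.
congr expect; apply/funext => x; rewrite expect_dbind mulrC -expectZ.
by congr expect; apply/funext => xs; rewrite expect_dret big_cons.
Qed.

Lemma outcomes_iid (T : eqType) (m : nat) (D : dist R T) (ts : m.-tuple T) :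
  ts \in outcomes (iid m D) -> {subset ts <= outcomes D}.
Proof.
elim: m ts => [|m IH] ts; first by rewrite tuple0.
case/outcomes_dbind=> x xD /outcomes_dbind [xs /IH xsD].
by rewrite mem_seq1 => /eqP -> t; rewrite inE => /predU1P [->|/xsD].
Qed.

End Expectation.

(** * Chernoff bounds and the union bound *)

Section Concentration.
Context {R : realType}.

(** Since e^(-y) >= 1 - y, one has (1 - y) e^y <= 1, while (1 - y)(1 + y + 2y^2) = 1 + y^2 (1 - 2y)
    >= 1. *)
Lemma expR_le_quadratic (y : R) : y <= 2^-1 -> expR y <= 1 + y + 2 * y ^+ 2.
Proof.
move=> y12.
have y1 : 0 < 1 - y by lra.
have : (1 - y) * expR y <= 1.
  rewrite -[leRHS](mulVf (lt0r_neq0 (expR_gt0 y))) ler_pM2r ?expR_gt0 //.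
  by rewrite -expRN expR_ge1Dx.
move/le_trans => H; rewrite -(ler_pM2l y1); apply: H.
rewrite -subr_ge0.
have -> : (1 - y) * (1 + y + 2 * y ^+ 2) - 1 = y ^+ 2 * (1 - 2 * y) by ring.
by rewrite mulr_ge0 ?sqr_ge0 //; lra.
Qed.

(** Centering removes the linear term of the quadratic bound on exp. The second moment is at most
    [B * a] because x^2 <= B |x|, so the first absolute moment [a] plays the part of a variance. *)
Lemma mgf_le (I : finType) (p x : I -> R) (mu B a t : R) :
  (forall l, 0 <= p l) -> \sum_l p l = 1 -> \sum_l p l * x l = mu ->
  (forall l, `|x l| <= B) -> \sum_l p l * `|x l| <= a ->
  0 <= t -> 4 * t * B <= 1 ->
  \sum_l p l * expR (t * (x l - mu)) <= expR (2 * t ^+ 2 * B * a).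
Proof.
move=> p0 p1 xmu xB xa t0 tB.
have muB : `|mu| <= B.
  rewrite -xmu; apply: (le_trans (ler_norm_sum _ _ _)).
  rewrite -[leRHS]mul1r -p1 mulr_suml; apply: ler_sum => l _.
  by rewrite normrM ger0_norm // ler_wpM2l.
have B0 : 0 <= B by exact: le_trans (normr_ge0 _) muB.
have sq : \sum_l p l * x l ^+ 2 <= B * a.
  apply: (le_trans _ (ler_wpM2l B0 xa)); rewrite mulr_sumr; apply: ler_sum => l _.
  by rewrite [leRHS]mulrCA ler_wpM2l // -real_normK ?num_real // expr2 ler_wpM2r.
apply: (@le_trans _ _ (1 + 2 * t ^+ 2 * \sum_l p l * x l ^+ 2)); last first.
  apply: le_trans (expR_ge1Dx _); rewrite lerD2l -[leRHS]mulrA ler_wpM2l //.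
  by rewrite mulr_ge0 // sqr_ge0.
apply: (@le_trans _ _
  (\sum_l p l * (1 + t * (x l - mu) + 2 * (t * (x l - mu)) ^+ 2))).
  apply: ler_sum => l _; rewrite ler_wpM2l //; apply: expR_le_quadratic.
  have : x l - mu <= 2 * B.
    by have := xB l; move: muB; rewrite !ler_norml => /andP[? ?] /andP[? ?]; lra.
  by move/(ler_wpM2l t0); lra.
(* Once [p1] and [xmu] are substituted, everything but the last sum equals 1 - 2 t^2 mu^2, which is
   at most 1. *)
have -> : \sum_l p l * (1 + t * (x l - mu) + 2 * (t * (x l - mu)) ^+ 2) =
    (1 - t * mu + 2 * t ^+ 2 * mu ^+ 2) * (\sum_l p l) +
    (t - 4 * t ^+ 2 * mu) * (\sum_l p l * x l) +
    2 * t ^+ 2 * \sum_l p l * x l ^+ 2.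
  by rewrite !mulr_sumr -!big_split /=; apply: eq_bigr => l _; ring.
rewrite p1 xmu lerD2r.
have : 0 <= t ^+ 2 * mu ^+ 2 by rewrite mulr_ge0 ?sqr_ge0.
lra.
Qed.

Lemma sum_tuple_sub (T : Type) (m : nat) (ts : m.-tuple T) (f : T -> R) (a : R) :
  \sum_(t <- ts) (f t - a) = \sum_(t <- ts) f t - m%:R * a.
Proof.
rewrite sumrB; congr (_ - _); rewrite big_const_seq count_predT size_tuple.
by rewrite iter_addr_0 mulr_natl.
Qed.

(** Exponential Markov inequality for each coordinate and each sign of the error, followed by a
    union bound. The parameter [t] may vary with the coordinate, and [A] only has to contain the
    event that all sample means are accurate. *)
Lemma Pr_sample_means (T : Type) (D : dist R T) (m : nat) (I : finType)
    (X : I -> T -> R) (mu r b : I -> R) (t : I -> R) (A : pred (m.-tuple T)) :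
  nonneg D -> expect D (fun=> 1) = 1 -> (0 < m)%N ->
  (forall i, 0 <= t i) ->
  (forall i (s : bool),
    expR (- t i * (m%:R * r i)) *
      expect D (fun x => expR (t i * ((-1) ^+ s * (X i x - mu i)))) ^+ m <= b i) ->
  (forall ts : m.-tuple T, (forall i, `|m%:R^-1 * \sum_(x <- ts) X i x - mu i| <= r i) -> A ts) ->
  1 - \sum_i 2 * b i <= Pr (iid m D) A.
Proof.
move=> D0 D1 m0 t0 tb goodA.
have m_gt0 : 0 < m%:R :> R by rewrite ltr0n.
(* [F] dominates the indicator of the complement of [A]: if coordinate [i] is off
   by more than [r i], the term whose sign [s] is that of the error exceeds 1. *)
pose Y i (s : bool) (ts : m.-tuple T) : R :=
  \prod_(x <- ts) expR (t i * ((-1) ^+ s * (X i x - mu i))).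
pose F (ts : m.-tuple T) : R := \sum_i \sum_(s : bool) expR (- t i * (m%:R * r i)) * Y i s ts.
have Y0 i s ts : 0 <= Y i s ts by apply: prodr_ge0 => x _; exact: expR_ge0.
have YE i s ts :
  Y i s ts = expR (t i * ((-1) ^+ s * (\sum_(x <- ts) X i x - m%:R * mu i))).
  by rewrite /Y -expR_sum -mulr_sumr -mulr_sumr sum_tuple_sub.
have bad ts : 1 - F ts <= (A ts)%:R.
  have F0 : 0 <= F ts.
    by apply: sumr_ge0 => i _; apply: sumr_ge0 => s _; rewrite mulr_ge0 ?expR_ge0.
  case: (boolP (A ts)) => [_|nA]; first by rewrite lerBlDr lerDl.
  have /existsNP [i] : ~ (forall i, `|m%:R^-1 * \sum_(x <- ts) X i x - mu i| <= r i).
    by move=> /goodA; apply/negP.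
  move/negP; rewrite -ltNge => ri.
  have [s sE] : exists s : bool, m%:R * r i <=
      (-1) ^+ s * (\sum_(x <- ts) X i x - m%:R * mu i).
    have E : \sum_(x <- ts) X i x - m%:R * mu i =
        m%:R * (m%:R^-1 * \sum_(x <- ts) X i x - mu i).
      by rewrite mulrBr mulVKf ?lt0r_neq0.
    move: ri; case: (ger0P (m%:R^-1 * \sum_(x <- ts) X i x - mu i)) => _ /ltW ri.
      by exists false; rewrite expr0 mul1r E ler_wpM2l.
    by exists true; rewrite expr1 mulN1r E -mulrN ler_wpM2l.
  rewrite subr_le0 /F (bigD1 i) //= (bigD1 s) //= YE -expRD.
  apply: (@le_trans _ _ (expR (- t i * (m%:R * r i) +
    t i * ((-1) ^+ s * (\sum_(x <- ts) X i x - m%:R * mu i))))).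
    by rewrite -[leLHS]expR0 ler_expR mulNr addrC subr_ge0 ler_wpM2l.
  rewrite -addrA lerDl addr_ge0 ?sumr_ge0 // => [s' _|i' _].
    by rewrite mulr_ge0 ?expR_ge0.
  by rewrite sumr_ge0 // => s' _; rewrite mulr_ge0 ?expR_ge0.
rewrite Pr_expect; apply: le_trans (le_expect (nonneg_iid m D0) bad).
have mass : expect (iid m D) (fun=> 1) = 1.
  have := expect_iid_prod m D (fun=> 1); rewrite D1 expr1n => {2}<-; congr expect.
  by apply/funext => ts; rewrite big1.
have -> : expect (iid m D) (fun ts => 1 - F ts) = 1 - expect (iid m D) F.
  rewrite -[in RHS]mulN1r -expectZ -[X in X + _]mass -expectD; congr expect.
  by apply/funext => ts; rewrite mulN1r.
rewrite lerD2l lerN2 expect_sum; apply: ler_sum => i _.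
rewrite expect_sum big_bool /=.
by rewrite !expectZ !expect_iid_prod [leRHS]mulr_natl mulr2n lerD //; apply: (tb i _).
Qed.

End Concentration.

(** * One run of the algorithm: law of the state and of the output *)

Section Algorithm.
Context {R : realType} {d : nat} (W : nat).
Hypothesis W_gt0 : (0 < W)%N.

Local Notation vec := 'rV[R]_d.
Local Notation triple := (vec * vec * vec)%type.

Definition scores (q : vec) (K : seq vec) : seq R :=
  [seq expR ((q *m k^T) 0 0) | k <- K].

Lemma sum_scores_gt0 (q : vec) (K : seq vec) :
  (0 < size K)%N -> 0 < \sum_(w <- scores q K) w.
Proof.
case: K => // k K _; rewrite big_cons ltr_wpDr ?expR_gt0 //.
by rewrite big_map sumr_ge0 // => k' _; exact: expR_ge0.
Qed.

(** The numerator [S - i + W] of the coin is just the total weight of the window. *)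
Lemma sub_window_weight (i j : nat) (w : R) :
  (j <= i)%N -> (i - j)%:R + w - i%:R + j%:R = w.
Proof. by move=> ji; rewrite natrB //; ring. Qed.

(** Only sizes are recorded; the contents of the window and the law of the reservoir are followed
    through expectations. *)
Definition swa_inv (k : nat) (st : state R d) : bool :=
  (size st.1.1 == minn k W) && (size st.1.2 == minn k W).

Lemma expect_swa_step_in (k : nat) (K V : seq vec) (vs : option vec)
    (x : triple) (f : state R d * vec -> R) :
  (k < W)%N ->
  let K' := rcons K x.1.2 in let V' := rcons V x.2 in
  expect (swa_step W k.+1 (K, V, vs) x) f =
  f ((K', V', vs), attn W x.1.1 (rows_mx k.+1 K') (rows_mx k.+1 V')).
Proof. by case: x => [[q k'] v] kW; rewrite /swa_step kW expect_dret. Qed.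

(** [G vs'] is the conditional mean of [f] once the reservoir coin has left [vs'] in store. *)
Lemma expect_swa_step_out (k : nat) (K V : seq vec) (vs : option vec)
    (x : triple) (f : state R d * vec -> R) :
  (W <= k)%N ->
  let K' := rcons (behead K) x.1.2 in let V' := rcons (behead V) x.2 in
  let a := (k.+1 - W)%:R in
  let S := a + \sum_(w <- scores x.1.1 K') w in
  let G vs' := S^-1 * (\sum_(wv <- zip (scores x.1.1 K') V')
                          wv.1 * f ((K', V', vs'), wv.2)
                       + a * f ((K', V', vs'), odflt 0 vs')) in
  expect (swa_step W k.+1 (K, V, vs) x) f =
  a^-1 * G (Some (head 0 V)) + (1 - a^-1) * G vs.
Proof.
case: x => [[q k'] v] /= kW; rewrite ltnNge kW /=.
rewrite expect_dbind expect_coin /=.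
set ws := scores _ _; set w := \sum_(w <- ws) w.
have w0 : 0 < w by apply: sum_scores_gt0; rewrite size_rcons.
have a0 : 0 <= (k.+1 - W)%:R :> R by [].
have S0 : (k.+1 - W)%:R + w != 0 by rewrite lt0r_neq0 // ltr_wpDl.
have SE : ((k.+1 - W)%:R + w - k.+1%:R + W%:R) = w.
  exact/sub_window_weight/leqW.
have inner vs' : expect
    (draw inside from coin (((k.+1 - W)%:R + w - k.+1%:R + W%:R) / ((k.+1 - W)%:R + w)) ;;
     draw o from (if inside then categorical ws (rcons (behead V) v)
                  else dret R (odflt 0 vs')) ;;
     dret R ((rcons (behead K) k', rcons (behead V) v, vs'), o)) f =
    ((k.+1 - W)%:R + w)^-1 * (\sum_(wv <- zip ws (rcons (behead V) v))
      wv.1 * f ((rcons (behead K) k', rcons (behead V) v, vs'), wv.2)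
    + (k.+1 - W)%:R * f ((rcons (behead K) k', rcons (behead V) v, vs'), odflt 0 vs')).
  rewrite expect_dbind expect_coin SE !expect_dbind expect_categorical.
  rewrite -/w !expect_dret.
  under eq_bigr do rewrite expect_dret.
  (* The coin probability w/S cancels the normaliser 1/w of the categorical draw, and the other
     branch has probability 1 - w/S = a/S. *)
  by field; rewrite S0 lt0r_neq0.
by congr (_ * _ + _ * _); rewrite inner.
Qed.

Lemma sum_zip_scores (q : vec) (K V : seq vec) :
  size K = size V ->
  \sum_(wv <- zip (scores q K) V) wv.1 = \sum_(w <- scores q K) w.
Proof.
move=> sKV; have wsV : (size (scores q K) <= size V)%N by rewrite size_map sKV.
by rewrite -[in RHS](unzip1_zip wsV) big_map.
Qed.

(** Summing out the output, whose weights add up to [S], leaves only the reservoir coin. *)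
Lemma expect_swa_step_state (k : nat) (K V : seq vec) (vs : option vec)
    (x : triple) (f : state R d -> R) :
  size K = size V -> (W <= k)%N ->
  let K' := rcons (behead K) x.1.2 in let V' := rcons (behead V) x.2 in
  let a : R := (k.+1 - W)%:R in
  expect (swa_step W k.+1 (K, V, vs) x) (fun r => f r.1) =
  a^-1 * f (K', V', Some (head 0 V)) + (1 - a^-1) * f (K', V', vs).
Proof.
move=> sKV kW; rewrite expect_swa_step_out //=.
set K' := rcons (behead K) _; set V' := rcons (behead V) _.
set S := (k.+1 - W)%:R + _.
have S0 : S != 0.
  by rewrite /S lt0r_neq0 // ltr_wpDl // sum_scores_gt0 // size_rcons.
have inner y : \sum_(wv <- zip (scores x.1.1 K') V') wv.1 * y + (k.+1 - W)%:R * y = S * y.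
  rewrite -mulr_suml -mulrDl addrC sum_zip_scores //.
  by rewrite !size_rcons !size_behead sKV.
by rewrite !inner !mulKf.
Qed.

Lemma expect_swa_step1 (k : nat) (st : state R d) (x : triple) :
  size st.1.1 = size st.1.2 -> expect (swa_step W k.+1 st x) (fun=> 1) = 1.
Proof.
case: st => [[K V] vs] sKV; rewrite /= in sKV; case: (ltnP k W) => kW.
  by rewrite expect_swa_step_in.
by rewrite (expect_swa_step_state _ _ (fun=> 1)) // !mulr1 addrC subrK.
Qed.

Lemma nonneg_swa_step (k : nat) (st : state R d) (x : triple) :
  nonneg (swa_step W k.+1 st x).
Proof.
case: st => [[K V] vs]; case: x => [[q k'] v] /=; case: ifP => kW.
  exact: nonneg_dret.
have {}kW : (W < k.+1)%N by rewrite ltnNge kW.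
have a1 : 1 <= (k.+1 - W)%:R :> R by rewrite ler1n subn_gt0.
have a0 : 0 < (k.+1 - W)%:R :> R := lt_le_trans ltr01 a1.
set ws := [seq _ | _ <- _]; set w := \sum_(w <- ws) w.
have w0 : 0 <= w by rewrite /w big_map sumr_ge0 // => ? _; exact: expR_ge0.
apply: nonneg_dbind => [|r].
  by apply: nonneg_coin; rewrite invr_ge0 ltW //= invf_le1.
apply: nonneg_dbind => [|b].
  apply: nonneg_coin.
  have -> : (k.+1 - W)%:R + w - k.+1%:R + W%:R = w.
    exact/sub_window_weight/ltnW.
  rewrite divr_ge0 ?addr_ge0 //= ?(ltW a0) // ler_pdivrMr ?ltr_wpDr // mul1r lerDr.
  exact: ltW.
apply: nonneg_dbind => [|o]; last exact: nonneg_dret.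
case: b; last exact: nonneg_dret.
by apply: nonneg_categorical; apply/allP => _ /mapP [? _ ->]; exact: expR_ge0.
Qed.

Lemma swa_inv_step (k : nat) (st : state R d) (x : triple) :
  swa_inv k st ->
  {in outcomes (swa_step W k.+1 st x), forall r, swa_inv k.+1 r.1}.
Proof.
case: st => [[K V] vs]; case: x => [[q k'] v]; rewrite /swa_inv /= => /andP [/eqP sK /eqP sV] r.
case: ifP => [kW|/negbT kW].
  rewrite mem_seq1 => /eqP -> /=; rewrite !size_rcons sK sV.
  lia.
case/outcomes_dbind => b _ /outcomes_dbind [b' _] /outcomes_dbind [u _].
rewrite mem_seq1 => /eqP -> /=; rewrite !size_rcons !size_behead sK sV.
lia.
Qed.

Lemma expect_swa_from1 (k : nat) (st : state R d) (s : seq triple) :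
  swa_inv k st -> expect (swa_from W k.+1 st s) (fun=> 1) = 1.
Proof.
elim: s k st => [|x s IH] k st inv; first by rewrite expect_dret.
rewrite /= expect_dbind -[RHS](@expect_swa_step1 k st x); last first.
  by case/andP: inv => /eqP -> /eqP ->.
apply: eq_expect => r /(swa_inv_step inv) inv'.
rewrite expect_dbind -[RHS](IH _ _ inv'); congr expect.
by apply/funext => t; rewrite expect_dret.
Qed.

Lemma nonneg_swa_from (k : nat) (st : state R d) (s : seq triple) :
  nonneg (swa_from W k.+1 st s).
Proof.
elim: s k st => [|x s IH] k st /=; first exact: nonneg_dret.
apply: nonneg_dbind => [|r]; first exact: nonneg_swa_step.
by apply: nonneg_dbind => [|t]; [exact: IH|exact: nonneg_dret].
Qed.

(** At most [W] keys, [W] values and one reservoir vector are stored. The bound covers every listed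
    outcome, so it is sure and not merely likely. *)
Lemma scalars_swa_from (k : nat) (st : state R d) (s : seq triple) :
  swa_inv k st ->
  {in outcomes (swa_from W k.+1 st s),
    forall t, all (fun r => scalars r.1 <= d * (2 * W + 1))%N t}.
Proof.
elim: s k st => [|x s IH] k st inv t; first by rewrite mem_seq1 => /eqP ->.
case/outcomes_dbind => r /(swa_inv_step inv) inv' /outcomes_dbind [t' /(IH _ _ inv') all_t'].
rewrite mem_seq1 => /eqP -> /=; rewrite all_t' andbT.
case: r inv' {all_t'} => [[[K V] vs] o]; rewrite /swa_inv /= => /andP [/eqP -> /eqP ->].
by rewrite leq_mul2l; apply/orP; right; case: vs; rewrite /=; lia.
Qed.

(** Law of the state alone, with past outputs forgotten: the next step depends on the past only
    through it. *)
Fixpoint state_after (k : nat) (st : state R d) (s : seq triple) : dist R (state R d) :=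
  if s is x :: s' then
    dbind (swa_step W k.+1 st x) (fun r => state_after k.+1 r.1 s')
  else dret R st.

(** The recursion consumes the stream from the front, whereas the reservoir induction needs the last
    step isolated. *)
Lemma expect_state_after_rcons (k : nat) (st : state R d) (s : seq triple)
    (x : triple) (f : state R d -> R) :
  expect (state_after k st (rcons s x)) f =
  expect (state_after k st s)
    (fun st' => expect (swa_step W (k + size s).+1 st' x) (fun r => f r.1)).
Proof.
elim: s k st => [|y s IH] k st /=.
  rewrite expect_dbind expect_dret addn0; congr expect.
  by apply/funext => r; rewrite expect_dret.
rewrite !expect_dbind; congr expect; apply/funext => r.
by rewrite IH addSnnS.
Qed.

(** The steps that follow have total mass 1 and integrate out. *)
Lemma expect_at_step (k : nat) (st : state R d) (s1 s2 : seq triple)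
    (x : triple) (f : state R d * vec -> R) :
  swa_inv k st ->
  expect (swa_from W k.+1 st (s1 ++ x :: s2)) (fun t => f (at_step t (size s1))) =
  expect (state_after k st s1)
    (fun st' => expect (swa_step W (k + size s1).+1 st' x) f).
Proof.
elim: s1 k st => [|y s1 IH] k st inv /=.
  rewrite expect_dbind expect_dret addn0; apply: eq_expect => r.
  move=> /(swa_inv_step inv) inv'; rewrite expect_dbind.
  rewrite -[RHS]mulr1 -(expect_swa_from1 s2 inv') -expectZ; congr expect.
  by apply/funext => t; rewrite expect_dret mulr1.
rewrite !expect_dbind; apply: eq_expect => r /(swa_inv_step inv) inv'.
rewrite expect_dbind -addSnnS -IH //; congr expect.
by apply/funext => t; rewrite expect_dret.
Qed.

Lemma swa_inv_state_after (k : nat) (st : state R d) (s : seq triple) :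
  swa_inv k st ->
  {in outcomes (state_after k st s), forall st', swa_inv (k + size s) st'}.
Proof.
elim: s k st => [|x s IH] k st inv st'.
  by rewrite mem_seq1 addn0 => /eqP ->.
case/outcomes_dbind => r /(swa_inv_step inv) inv' /(IH _ _ inv').
by rewrite /= addSnnS.
Qed.

Lemma swa_inv_empty : swa_inv 0 (empty_state R d).
Proof. by rewrite /swa_inv /= min0n. Qed.

Definition keys (s : seq triple) : seq vec := [seq x.1.2 | x <- s].
Definition vals (s : seq triple) : seq vec := [seq x.2 | x <- s].

Lemma state_after_in (s : seq triple) (f : state R d -> R) :
  (size s <= W)%N ->
  expect (state_after 0 (empty_state R d) s) f = f (keys s, vals s, None).
Proof.
elim/last_ind: s f => [|s x IH] f; first by rewrite expect_dret.
rewrite size_rcons => sW; rewrite expect_state_after_rcons IH ?(ltnW sW) //.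
by rewrite add0n expect_swa_step_in // /keys /vals !map_rcons.
Qed.

Lemma drop_rcons_behead (T : Type) (a : nat) (s : seq T) (x : T) :
  (a < size s)%N -> rcons (behead (drop a s)) x = drop a.+1 (rcons s x).
Proof. by move=> sa; rewrite drop_rcons // -drop1 drop_drop add1n. Qed.

(** The reservoir invariant: with [a] evicted values, the stored one is uniform among them. At the
    next step the newcomer gets 1/(a+1), and each earlier value keeps (1/a)(1 - 1/(a+1)) =
    1/(a+1). *)
Lemma state_after_out (s : seq triple) (f : state R d -> R) :
  (W < size s)%N -> let a := (size s - W)%N in
  expect (state_after 0 (empty_state R d) s) f =
  a%:R^-1 * \sum_(v <- take a (vals s)) f (drop a (keys s), drop a (vals s), Some v).
Proof.
elim/last_ind: s f => [|s x IH] f; first by rewrite ltn0.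
rewrite size_rcons /= ltnS => sW; rewrite expect_state_after_rcons add0n.
have a_lt : (size s - W < size s)%N by lia.
have -> : ((size s).+1 - W = (size s - W).+1)%N by lia.
set a := (size s - W)%N in IH a_lt *.
have kE : rcons (behead (drop a (keys s))) x.1.2 = drop a.+1 (keys (rcons s x)).
  by rewrite /keys map_rcons drop_rcons_behead ?size_map.
have vE : rcons (behead (drop a (vals s))) x.2 = drop a.+1 (vals (rcons s x)).
  by rewrite /vals map_rcons drop_rcons_behead ?size_map.
(* The window is non-empty, so its head is the true oldest value and not the default 0; it is the
   one evicted now. *)
have takeE : take a.+1 (vals (rcons s x)) = rcons (take a (vals s)) (head 0 (drop a (vals s))).
  have av : (a < size (vals s))%N by rewrite size_map.
  by rewrite /vals map_rcons -cats1 takel_cat // (take_nth 0) // -nth0 nth_drop addn0.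
rewrite takeE -kE -vE -cats1 big_cat big_seq1 /=.
pose F v := f (rcons (behead (drop a (keys s))) x.1.2,
  rcons (behead (drop a (vals s))) x.2, Some v).
rewrite -/(F (head 0 _)).
have step vs : expect (swa_step W (size s).+1 (drop a (keys s), drop a (vals s), vs) x)
    (fun r => f r.1) =
    a.+1%:R^-1 * F (head 0 (drop a (vals s))) + (1 - a.+1%:R^-1) *
    f (rcons (behead (drop a (keys s))) x.1.2, rcons (behead (drop a (vals s))) x.2, vs).
  rewrite expect_swa_step_state ?size_drop ?size_map //.
  by have -> : ((size s).+1 - W = a.+1)%N by rewrite /a; lia.
have a1 : a.+1%:R != 0 :> R by rewrite pnatr_eq0.
(* For [a] = 0 this is the first eviction: the replacement probability is 1, so the initial [None]
   disappears. *)
have [a0|a_gt0] := posnP a.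
  have sWE : size s = W by rewrite /a in a0; lia.
  rewrite state_after_in ?sWE //.
  move: step; rewrite -sWE a0 !drop0 => ->.
  by rewrite invr1 subrr mul0r addr0 take0 big_nil add0r.
have a_neq0 : a%:R != 0 :> R by rewrite pnatr_eq0 -lt0n.
rewrite IH; last by rewrite /a in a_gt0; lia.
rewrite (eq_bigr _ (fun v _ => step (Some v))).
rewrite big_split /= -mulr_sumr big_const_seq count_predT size_take size_map a_lt.
rewrite iter_addr_0 -mulr_sumr -/F -[a.+1]addn1 natrD.
by field; rewrite a_neq0 natr1 a1.
Qed.

(* Given the new state [st], the output has conditional expectation [H st], so
   the law of the state after one more step determines its mean. *)
Lemma expect_output_out (s : seq triple) (x : triple) (g : vec -> R) :
  (W <= size s)%N ->
  let a := ((size s).+1 - W)%N in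
  let K' := drop a (keys (rcons s x)) in let V' := drop a (vals (rcons s x)) in
  expect (state_after 0 (empty_state R d) s)
    (fun st => expect (swa_step W (size s).+1 st x) (fun r => g r.2)) =
  (a%:R + \sum_(w <- scores x.1.1 K') w)^-1 *
    (\sum_(v <- take a (vals (rcons s x))) g v +
     \sum_(wv <- zip (scores x.1.1 K') V') wv.1 * g wv.2).
Proof.
move=> sW /=; set a := ((size s).+1 - W)%N.
pose H (st : state R d) : R := (a%:R + \sum_(w <- scores x.1.1 st.1.1) w)^-1 *
  (\sum_(wv <- zip (scores x.1.1 st.1.1) st.1.2) wv.1 * g wv.2
   + a%:R * g (odflt 0 st.2)).
have -> : expect (state_after 0 (empty_state R d) s)
    (fun st => expect (swa_step W (size s).+1 st x) (fun r => g r.2)) =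
    expect (state_after 0 (empty_state R d) (rcons s x)) H.
  rewrite expect_state_after_rcons add0n; apply: eq_expect => -[[K V] vs].
  move=> /(swa_inv_state_after swa_inv_empty) /andP [/eqP sK /eqP sV].
  by rewrite expect_swa_step_state // ?expect_swa_step_out //= sK sV.
rewrite state_after_out size_rcons ?ltnS // -/a /H /=.
set Z := (_ + _)^-1; set Y := \sum_(wv <- zip _ _) _.
have a0 : a%:R != 0 :> R by rewrite pnatr_eq0 -lt0n /a; lia.
rewrite -mulr_sumr big_split /= -mulr_sumr big_const_seq count_predT size_take.
rewrite size_map size_rcons iter_addr_0 ifT; last by rewrite /a; lia.
by rewrite mulrCA -[Y *+ a]mulr_natl -mulrDr mulKf // [Y + _]addrC.
Qed.

(** Evicted values, of weight 1, and window values, of exponential weight, merge into one sum over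
    all positions. With [g] constant equal to 1 it also yields the normaliser. *)
Lemma sum_window (K V : seq vec) (q : vec) (a : nat) (g : vec -> R) :
  size K = size V -> (a <= size V)%N ->
  \sum_(v <- take a V) g v +
  \sum_(wv <- zip (scores q (drop a K)) (drop a V)) wv.1 * g wv.2 =
  \sum_(l < size V)
    (if (l < a)%N then 1 else expR ((q *m (nth 0 K l)^T) 0 0)) * g (nth 0 V l).
Proof.
move=> sKV aV.
rewrite -(big_mkord xpredT (fun l => (if (l < a)%N then 1 else
  expR ((q *m (nth 0 K l)^T) 0 0)) * g (nth 0 V l))).
rewrite (big_cat_nat _ (n := a)) //=; congr (_ + _).
  rewrite (big_nth 0) size_takel //; apply: eq_big_nat => l /andP [_ la].
  by rewrite la mul1r nth_take.
rewrite (big_nth (0, 0)) size_zip size_map !size_drop sKV minnn.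
rewrite -[X in _ = \sum_(X <= _ < _) _]add0n big_addn.
apply: eq_big_nat => l /andP [_ la].
rewrite ltnNge leq_addl /= nth_zip; last by rewrite size_map !size_drop sKV.
by rewrite /scores (nth_map 0) ?size_drop ?sKV //= !nth_drop addnC.
Qed.

End Algorithm.

(** * Matching the output law with the softmax weights *)

Section Stream.
Context {R : realType} {d : nat} (W : nat).
Hypothesis W_gt0 : (0 < W)%N.
Variables (n : nat) (Q K V : 'M[R]_(n, d)) (i : 'I_n).

Local Notation triple := ('rV[R]_d * 'rV[R]_d * 'rV[R]_d)%type.

Let stream : seq triple := [seq (row l Q, row l K, row l V) | l <- enum 'I_n].
Let item : triple := (row i Q, row i K, row i V).

Lemma size_stream : size stream = n.
Proof. by rewrite size_map size_enum_ord. Qed.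

Lemma nth_stream (x0 : triple) (l : 'I_n) :
  nth x0 stream l = (row l Q, row l K, row l V).
Proof. by rewrite (nth_map i) ?nth_ord_enum // size_enum_ord. Qed.

Lemma take_stream : rcons (take i stream) item = take i.+1 stream.
Proof. by rewrite (take_nth item) ?size_stream // nth_stream. Qed.

Lemma size_take_stream : size (take i stream) = i.
Proof. by rewrite size_takel // size_stream ltnW. Qed.

Lemma nth_keys_stream (l : 'I_i.+1) :
  nth 0 (keys (take i.+1 stream)) l = row l (first_rows i K).
Proof.
rewrite /keys (nth_map item) ?size_takel ?size_stream //.
rewrite nth_take // (nth_stream item (widen_ord (ltn_ord i) l)).
by apply/rowP => j; rewrite !mxE.
Qed.

Lemma nth_vals_stream (l : 'I_i.+1) :
  nth 0 (vals (take i.+1 stream)) l = row l (first_rows i V).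
Proof.
rewrite /vals (nth_map item) ?size_takel ?size_stream //.
rewrite nth_take // (nth_stream item (widen_ord (ltn_ord i) l)).
by apply/rowP => j; rewrite !mxE.
Qed.

Lemma expect_swa_at (f : state R d * 'rV[R]_d -> R) :
  expect (swa W Q K V) (fun t => f (at_step t i)) =
  expect (state_after W 0 (empty_state R d) (take i stream))
    (fun st => expect (swa_step W i.+1 st item) f).
Proof.
have := @expect_at_step R d W W_gt0 0 (empty_state R d) (take i stream)
  (drop i.+1 stream) item f (swa_inv_empty W).
by rewrite size_take_stream -cat_rcons take_stream cat_take_drop.
Qed.

(** No coin is tossed during the first [W] steps, so the output is deterministic. *)
Lemma expect_swa_in (g : 'rV[R]_d -> R) :
  (i < W)%N ->
  expect (swa W Q K V) (fun t => g (at_step t i).2) =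
  g (attn W (row i Q) (first_rows i K) (first_rows i V)).
Proof.
move=> iW; rewrite (expect_swa_at (fun r => g r.2)).
rewrite state_after_in ?size_take_stream ?(ltnW iW) // expect_swa_step_in //=.
have -> : rcons (keys (take i stream)) (row i K) = keys (take i.+1 stream).
  by rewrite -take_stream /keys map_rcons.
have -> : rcons (vals (take i stream)) (row i V) = vals (take i.+1 stream).
  by rewrite -take_stream /vals map_rcons.
congr (g (attn _ _ _ _)); apply/row_matrixP => l; apply/rowP => j.
  by rewrite -nth_keys_stream !mxE.
by rewrite -nth_vals_stream !mxE.
Qed.

Definition attn_weight (l : 'I_i.+1) : R :=
  softmax (masked W (first_rows i K *m (row i Q)^T)) l 0.

Lemma attn_weight_ge0 (l : 'I_i.+1) : 0 <= attn_weight l.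
Proof.
by rewrite /attn_weight mxE divr_ge0 ?expR_ge0 // sumr_ge0 // => l' _; exact: expR_ge0.
Qed.

Lemma sum_attn_weight : \sum_l attn_weight l = 1.
Proof.
rewrite /attn_weight; under eq_bigr do rewrite mxE.
rewrite -mulr_suml mulfV // lt0r_neq0 // (bigD1 ord0) //=.
by rewrite ltr_wpDr ?expR_gt0 // sumr_ge0 // => l' _; exact: expR_ge0.
Qed.

Lemma attn_weightE (j : 'I_d) (U : 'M[R]_(i.+1, d)) :
  attn W (row i Q) (first_rows i K) U 0 j = \sum_l attn_weight l * U l j.
Proof. by rewrite mxE; apply: eq_bigr => l _; rewrite mxE. Qed.

(** The reservoir branch has probability a/S and is uniform over [a] values, so each evicted value
    has probability 1/S: this is the softmax weight of a masked score, as e^0 = 1. *)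
Lemma expect_swa_out (g : 'rV[R]_d -> R) :
  (W <= i)%N ->
  expect (swa W Q K V) (fun t => g (at_step t i).2) =
  \sum_l attn_weight l * g (row l (first_rows i V)).
Proof.
move=> Wi; rewrite (expect_swa_at (fun r => g r.2)).
have := @expect_output_out R d W W_gt0 (take i stream) item g.
rewrite size_take_stream => /(_ Wi) /=; rewrite take_stream => ->.
have sk : size (keys (take i.+1 stream)) = i.+1.
  by rewrite size_map size_takel // size_stream.
have sv : size (vals (take i.+1 stream)) = i.+1.
  by rewrite size_map size_takel // size_stream.
have skv : size (keys (take i.+1 stream)) = size (vals (take i.+1 stream)).
  by rewrite sk sv.
have aE : (i.+1 - W <= size (vals (take i.+1 stream)))%N by rewrite sv leq_subr.
(* In 0-based indexing the masked positions are exactly those with [l < i.+1 - W], the evicted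
   ones. *)
have weightE (l : 'I_i.+1) :
    (if (l < i.+1 - W)%N then 1 else
       expR ((row i Q *m (nth 0 (keys (take i.+1 stream)) l)^T) 0 0)) =
    expR (masked W (first_rows i K *m (row i Q)^T) l 0).
  rewrite nth_keys_stream !mxE [in RHS]ltnS; case: (ltnP l) => _.
    by rewrite mulr0 expR0.
  by rewrite mulr1; congr expR; apply: eq_bigr => j _; rewrite !mxE mulrC.
rewrite (sum_window (row i Q) g skv aE).
(* The normaliser [S] is the softmax denominator, by [sum_window] at the constant function 1. *)
have -> : (i.+1 - W)%:R + \sum_(w <- scores (row i Q)
    (drop (i.+1 - W) (keys (take i.+1 stream)))) w =
  \sum_l expR (masked W (first_rows i K *m (row i Q)^T) l 0).
  have := sum_window (row i Q) (fun=> 1) skv aE.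
  rewrite -mulr_suml mulr1 sum_zip_scores ?size_drop ?skv //.
  rewrite big_const_seq count_predT size_takel // iter_addr_0 => ->.
  by rewrite sv; apply: eq_bigr => l _; rewrite mulr1 weightE.
rewrite sv mulr_sumr; apply: eq_bigr => l _.
by rewrite weightE nth_vals_stream /attn_weight [in RHS]mxE mulrAC [in RHS]mulrC mulrA.
Qed.

End Stream.

Lemma le_mx_norm (R : realType) (m n : nat) (A : 'M[R]_(m, n)) (i : 'I_m) (j : 'I_n) :
  `|A i j| <= mx_norm A.
Proof.
rewrite mx_normrE; exact: (le_bigmax _ (fun ij : 'I_m * 'I_n => `|A ij.1 ij.2|) (i, j)).
Qed.

(** Each copy is charged 2W + 1 state vectors and one sample; the constant 4 comes from 2W + 2 <=
    4W. *)
Lemma copy_space_le (d W : nat) :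
  (0 < W)%N -> (d * (2 * W + 1) + d <= 4 * (d * W))%N.
Proof. nia. Qed.

(** * Failure probability at one step and one coordinate *)

Section Tail.
Context {R : realType} {n d : nat} (W : nat).
Hypothesis W_gt0 : (0 < W)%N.
Variables (Q K V : 'M[R]_(n, d)) (i : 'I_n) (j : 'I_d).
Variables (B c kappa eps delta : R) (m : nat).

Let mu : R := attn W (row i Q) (first_rows i K) (first_rows i V) 0 j.
Let nd : R := (n * d)%:R.

Hypotheses (VB : forall l, `|V l j| <= B) (c_gt0 : 0 < c) (kappa_gt0 : 0 < kappa).
Hypotheses (eps01 : 0 < eps < 1) (delta01 : 0 < delta < 1) (m_gt0 : (0 < m)%N).
Hypotheses (c_mu : c <= `|mu|).
Hypothesis kappa_mu :
  attn W (row i Q) (first_rows i K) (map_mx Num.norm (first_rows i V)) 0 j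
  <= kappa * `|mu|.
Hypothesis m_large :
  16 * (kappa + 1) / c * (B * eps ^- 2 * ln (nd / delta)) <= m%:R.

(** Attention is a convex combination of value rows. *)
Lemma abs_attn_le : `|mu| <= B.
Proof.
rewrite /mu attn_weightE; apply: (le_trans (ler_norm_sum _ _ _)).
rewrite -[leRHS]mul1r -(sum_attn_weight W Q K i) mulr_suml; apply: ler_sum => l _.
by rewrite normrM ger0_norm ?attn_weight_ge0 // ler_wpM2l ?attn_weight_ge0 // mxE.
Qed.

(** [mgf_le] is applied to the values multiplied by the sign, which treats both tails at once. *)
Lemma mgf_window (t : R) (s : bool) :
  (W <= i)%N -> 0 <= t -> 4 * t * B <= 1 ->
  expect (swa W Q K V)
    (fun x => expR (t * ((-1) ^+ s * ((at_step x i).2 0 j - mu)))) <=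
  expR (2 * t ^+ 2 * B * (kappa * `|mu|)).
Proof.
move=> Wi t0 tB.
rewrite (expect_swa_out W_gt0 Q K V (fun v => expR (t * ((-1) ^+ s * (v 0 j - mu))))) //.
under eq_bigr do rewrite mulrBr.
apply: mgf_le => //.
- exact: attn_weight_ge0.
- exact: sum_attn_weight.
- rewrite /mu attn_weightE mulr_sumr; apply: eq_bigr => l _.
  by rewrite mulrCA !mxE.
- by move=> l; rewrite normrM normrX normrN1 expr1n mul1r !mxE.
apply: le_trans kappa_mu; rewrite attn_weightE; apply: ler_sum => l _.
by rewrite normrM normrX normrN1 expr1n mul1r !mxE.
Qed.

(** There are 2nd one-sided failure events, and each is allotted delta/(2nd). The same [t] serves
    both signs. *)
Lemma chernoff_exponent :
  exists2 t, 0 <= t & forall s : bool,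
    expR (- t * (m%:R * (eps * `|mu|))) *
    expect (swa W Q K V)
      (fun x => expR (t * ((-1) ^+ s * ((at_step x i).2 0 j - mu)))) ^+ m
    <= delta / (2 * nd).
Proof.
have [eps0 eps1] := andP eps01; have [delta0 delta1] := andP delta01.
have n0 : (0 < n)%N := leq_ltn_trans (leq0n i) (ltn_ord i).
have d0 : (0 < d)%N := leq_ltn_trans (leq0n j) (ltn_ord j).
have nd1 : 1 <= nd by rewrite ler1n muln_gt0 n0.
have nd0 : 0 < nd := lt_le_trans ltr01 nd1.
have mu0 : 0 < `|mu| := lt_le_trans c_gt0 c_mu.
have m0 : 0 < m%:R :> R by rewrite ltr0n.
have B0 : 0 < B := lt_le_trans mu0 abs_attn_le.
have y0 : 0 < m%:R * (eps * `|mu|) by rewrite !mulr_gt0.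
have [iW|Wi] := ltnP i W.
  (* The output is exact at this step, so [t] may be as large as needed. *)
  have r1 : 1 <= 2 * nd / delta.
    by rewrite ler_pdivlMr // mul1r (le_trans (ltW delta1)) //; lra.
  exists (ln (2 * nd / delta) / (m%:R * (eps * `|mu|))).
    by rewrite divr_ge0 ?ln_ge0 // ltW.
  move=> s; set t := _ / _.
  rewrite (expect_swa_in W_gt0 Q K V (fun v => expR (t * ((-1) ^+ s * (v 0 j - mu))))) //.
  rewrite subrr !mulr0 expR0 expr1n mulr1 mulNr /t divfK ?lt0r_neq0 //.
  by rewrite expRN lnK ?posrE ?(lt_le_trans ltr01 r1) // invf_div.
(* This is where the factor 2 of the two-sided bound is absorbed; it fails for
   n = d = 1, but a step outside the first window forces n > 1. *)
have nd2 : 2 <= nd.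
  rewrite /nd -[2]/(2%:R) ler_nat -[2%N]muln1 leq_mul //.
  exact: leq_trans (leq_ltn_trans Wi (ltn_ord i)).
pose L := ln (nd / delta).
have mL : 16 * (kappa + 1) / c * (B * eps ^- 2 * L) <= m%:R := m_large.
have L0 : 0 <= L.
  by rewrite ln_ge0 // ler_pdivlMr // mul1r (le_trans (ltW delta1)).
pose t := eps / (4 * (kappa + 1) * B).
have t0 : 0 < t by rewrite divr_gt0 // !mulr_gt0 // addr_gt0.
have k0 : 0 < kappa + 1 by rewrite addr_gt0.
exists t => [|s]; first exact: ltW.
have tB : 4 * t * B = eps / (kappa + 1).
  by rewrite /t; field; rewrite !lt0r_neq0.
have tB1 : 4 * t * B <= 1.
  by rewrite tB ler_pdivrMr // mul1r (le_trans (ltW eps1)) // lerDr ltW.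
have expect_ge0 : 0 <= expect (swa W Q K V)
   (fun x => expR (t * ((-1) ^+ s * ((at_step x i).2 0 j - mu)))).
  rewrite (expect_swa_out W_gt0 Q K V (fun v => expR (t * ((-1) ^+ s * (v 0 j - mu))))) //.
  by rewrite sumr_ge0 // => l _; rewrite mulr_ge0 ?expR_ge0 ?attn_weight_ge0.
have := lerXn2r m expect_ge0 (expR_ge0 _) (mgf_window s Wi (ltW t0) tB1).
move/(ler_wpM2l (expR_ge0 (- t * (m%:R * (eps * `|mu|))))).
move/le_trans; apply.
rewrite -expRM_natl -expRD.
(* The choice of [t] makes the quadratic term at most half of the linear gain [t * eps]. *)
have tB' : 2 * t ^+ 2 * B * kappa <= t * eps / 2.
  have -> : 2 * t ^+ 2 * B * kappa = t * eps / 2 * (kappa / (kappa + 1)).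
    rewrite (_ : 2 * t ^+ 2 * B * kappa = (4 * t * B) * t * kappa / 2); last by field.
    by rewrite tB; field; rewrite lt0r_neq0.
  apply: ler_piMr; first by apply/ltW/divr_gt0 => //; exact: mulr_gt0.
  by rewrite ler_pdivrMr // mul1r lerDl.
have exponent : - t * (m%:R * (eps * `|mu|)) +
    m%:R * (2 * t ^+ 2 * B * (kappa * `|mu|)) <= - (2 * L).
  have mmu : 0 <= m%:R * `|mu| by rewrite mulr_ge0.
  have H1 := ler_wpM2l mmu tB'.
  have H2 : m%:R * c * (t * eps / 2) <= m%:R * `|mu| * (t * eps / 2).
    apply: ler_wpM2r; first by apply/ltW/divr_gt0 => //; exact: mulr_gt0.
    exact: ler_wpM2l.
  (* The constant 16 in [m_large] is fixed here: 16/(4 * 2) = 2, and both sides agree once [m] is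
     replaced by its lower bound. *)
  have H3 : 2 * L <= m%:R * c * (t * eps / 2).
    have ct : 0 <= c * (t * eps / 2) by apply/ltW/mulr_gt0 => //; apply: divr_gt0 => //; exact: mulr_gt0.
    have := ler_wpM2r ct mL; rewrite [leRHS]mulrA; apply: le_trans.
    rewrite /t le_eqVlt; apply/orP; left; apply/eqP; field.
    by rewrite !lt0r_neq0.
  lra.
have LE : expR (- (2 * L)) = (delta / nd) ^+ 2.
  rewrite -mulrN /L expRM_natl expRN lnK ?posrE ?divr_gt0 //.
  by rewrite invf_div.
apply: (@le_trans _ _ (expR (- (2 * L)))); first by rewrite ler_expR.
rewrite LE -subr_ge0.
(* The exponent 2L gives the square of delta/nd, which is below delta/(2nd) because 2 delta <= 2 <=
   nd. *)
have -> : delta / (2 * nd) - (delta / nd) ^+ 2 =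
    delta / (2 * nd ^+ 2) * (nd - 2 * delta).
  by field; rewrite !pnatr_eq0 -!lt0n n0 d0.
apply: mulr_ge0; last by lra.
by apply/ltW/divr_gt0 => //; rewrite mulr_gt0 // exprn_gt0.
Qed.

End Tail.

(** The constant in Omega(1) is [c], and [kappa] limits the cancellation between values of opposite
    signs; nonnegative values allow [kappa] = 1. [C] depends on these two only, and [m] and [est]
    are fixed before the stream is given. *)
Theorem theorem25 (R : realType) (c kappa : R) (c_gt0 : 0 < c)
    (kappa_gt0 : 0 < kappa) :
  exists2 C : R, 0 < C &
  forall (n d W : nat) (eps delta normV : R),
    (0 < n)%N -> (0 < d)%N -> (0 < W)%N ->
    0 < eps < 1 -> 0 < delta < 1 -> 0 <= normV ->
  let N : R := (Num.ceil (normV * eps ^- 2 * ln ((n * d)%:R / delta)))%:~R in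
  exists (m : nat) (est : m.-tuple 'rV[R]_d -> 'rV[R]_d),
    m%:R <= C * N /\
    forall Q K V : 'M[R]_(n, d),
      mx_norm V = normV ->
      (forall (i : 'I_n) (j : 'I_d),
         c <= `|attn W (row i Q) (first_rows i K) (first_rows i V) 0 j|) ->
      (forall (i : 'I_n) (j : 'I_d),
         attn W (row i Q) (first_rows i K) (map_mx Num.norm (first_rows i V)) 0 j
         <= kappa * `|attn W (row i Q) (first_rows i K) (first_rows i V) 0 j|) ->
      1 - delta <=
        Pr (iid m (swa W Q K V)) (fun ts =>
          [forall i : 'I_n, forall j : 'I_d,
             `|est (samples ts i) 0 j
               - attn W (row i Q) (first_rows i K) (first_rows i V) 0 j|
             <= eps * `|attn W (row i Q) (first_rows i K) (first_rows i V) 0 j|])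
      /\
      (forall ts, ts \in outcomes (iid m (swa W Q K V)) ->
         forall i : 'I_n, (total_scalars ts i)%:R <= C * (d * W)%:R * N).
Proof.
pose ratio := 16 * (kappa + 1) / c.
have ratio_ge0 : 0 <= ratio by apply/ltW/divr_gt0 => //; rewrite mulr_gt0 // addr_gt0.
(* Rounding the ratio up to a natural number makes [m] a natural multiple of the ceiling. *)
pose C0 := Num.bound ratio.
have ratio_C0 : ratio < C0%:R by exact: archi_boundP.
have C0_gt0 : 0 < C0%:R :> R := le_lt_trans ratio_ge0 ratio_C0.
(* The factor 4 is the one of [copy_space_le]; the sample count alone would do with [C0]. *)
exists (4 * C0%:R); first by rewrite mulr_gt0.
move=> n d W eps delta normV n0 d0 W0 eps01 delta01 normV0 N.
have [eps0 eps1] := andP eps01; have [delta0 delta1] := andP delta01.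
pose X := normV * eps ^- 2 * ln ((n * d)%:R / delta).
have r1 : 1 < (n * d)%:R / delta.
  by rewrite ltr_pdivlMr // mul1r (lt_le_trans delta1) // ler1n muln_gt0 n0.
have X_ge0 : 0 <= X by rewrite !mulr_ge0 ?invr_ge0 ?sqr_ge0 ?ln_ge0 ?(ltW r1).
have ceil0 : 0 <= Num.ceil X by rewrite ceil_ge0 (lt_le_trans _ X_ge0) ?ltrN10.
pose m := (C0 * `|Num.ceil X|)%N.
have mE : m%:R = C0%:R * N.
  by rewrite /m natrM natr_absz ger0_norm.
have N_ge0 : 0 <= N by rewrite /N ler0z.
exists m, (fun vs : m.-tuple 'rV[R]_d => \row_j (m%:R^-1 * \sum_(v <- vs) v 0 j)).
split; first by rewrite mE ler_wpM2r // ler_peMl ?ltW // ltr1n.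
move=> Q K V VE attn_ge attn_le; split; last first.
  move=> ts ts_out i.
  have bound : (total_scalars ts i <= m * (4 * (d * W)))%N.
    have -> : (m * (4 * (d * W)) = \sum_(t <- ts) 4 * (d * W))%N.
      by rewrite big_const_seq count_predT size_tuple iter_addn_0 mulnC.
    rewrite /total_scalars !big_seq; apply: leq_sum => t /(outcomes_iid ts_out).
    move=> /(scalars_swa_from W0 (swa_inv_empty W)) /(all_nthP (empty_state R d, 0)) st.
    have : (scalars (at_step t i).1 <= d * (2 * W + 1))%N.
      (* Beyond the end of a trace, [at_step] returns the empty state, which stores nothing. *)
      rewrite /at_step; case: (ltnP i (size t)) => [/st //|ti].
      by rewrite nth_default //= muln0.
    rewrite -(leq_add2r d) => /leq_trans; apply.
    exact: copy_space_le.
  apply: (@le_trans _ _ (m * (4 * (d * W)))%:R); first by rewrite ler_nat.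
  by rewrite natrM mE natrM le_eqVlt; apply/orP; left; apply/eqP; ring.
have VB i j : `|V i j| <= normV by rewrite -VE le_mx_norm.
(* Attention bounded away from 0 forces [V] to be nonzero, so at least one copy is run and the
   sample mean is meaningful. *)
have normV_gt0 : 0 < normV.
  pose i0 := Ordinal n0; pose j0 := Ordinal d0.
  have := @abs_attn_le R n d W Q K V i0 j0 normV (fun l => VB l j0).
  by apply: lt_le_trans; exact: lt_le_trans c_gt0 (attn_ge i0 j0).
have X_gt0 : 0 < X by rewrite !mulr_gt0 ?invr_gt0 ?exprn_gt0 ?ln_gt0.
have m0 : (0 < m)%N.
  by rewrite /m muln_gt0 -(ltr0n R) C0_gt0 absz_gt0 gt_eqF // ceil_gt0.
have m_large : ratio * X <= m%:R.
  by rewrite mE ler_pM ?(ltW ratio_C0) // /N ceil_ge.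
(* The Chernoff parameter depends on the pair (i, j), so a function of pairs is chosen. *)
have /boolp.choice [t tP] : forall ij : 'I_n * 'I_d, exists t, 0 <= t /\ forall s : bool,
    let mu := attn W (row ij.1 Q) (first_rows ij.1 K) (first_rows ij.1 V) 0 ij.2 in
    expR (- t * (m%:R * (eps * `|mu|))) *
    expect (swa W Q K V)
      (fun x => expR (t * ((-1) ^+ s * ((at_step x ij.1).2 0 ij.2 - mu)))) ^+ m
    <= delta / (2 * (n * d)%:R).
  move=> [i j] /=.
  have [t t0 tP] := chernoff_exponent W0 (fun l => VB l j) c_gt0 kappa_gt0 eps01
    delta01 m0 (attn_ge i j) (attn_le i j) m_large.
  by exists t.
have mass : expect (swa W Q K V) (fun=> 1) = 1.
  by apply: expect_swa_from1 => //; exact: swa_inv_empty.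
have := @Pr_sample_means R _ (swa W Q K V) m ('I_n * 'I_d)%type
  (fun ij x => (at_step x ij.1).2 0 ij.2)
  (fun ij => attn W (row ij.1 Q) (first_rows ij.1 K) (first_rows ij.1 V) 0 ij.2)
  (fun ij => eps * `|attn W (row ij.1 Q) (first_rows ij.1 K) (first_rows ij.1 V) 0 ij.2|)
  (fun=> delta / (2 * (n * d)%:R)) t.
move=> /(_ _ (nonneg_swa_from _ _ _ _) mass m0 (fun ij => (tP ij).1)
  (fun ij => (tP ij).2)) Pr_ge.
apply: le_trans (Pr_ge _ _).
  (* The nd pairs each contribute 2 * delta/(2nd), for a total of exactly [delta]. *)
  rewrite sumr_const card_prod !card_ord lerD2l lerN2.
  rewrite -mulr_natl le_eqVlt; apply/orP; left; apply/eqP.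
  by field; rewrite !pnatr_eq0 -!lt0n n0 d0.
move=> ts close; apply/forallP => i; apply/forallP => j.
by rewrite mxE big_map; exact: (close (i, j)).
Qed.
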